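(* Let $T\subset\mathbb{R}^2$ be a triangle with no obtuse angle, with edges $e_1,e_2,e_3$ and corresponding unit tangential vectors $\mathbf{t}_1,\mathbf{t}_2,\mathbf{t}_3$, cut by a segment $\Gamma^T_h$ into $T_h^-$ and $T_h^+$, and let $\mu^\pm>0$, $\beta^\pm>0$. Let $\mathcal{IND}_h(T)$ be the local immersed finite element space defined in the context. Then for each $[v_1,v_2,v_3]\in\mathbb{R}^3$ there exists a unique $\mathbf{z}\in\mathcal{IND}_h(T)$ such that $$\int_{e_i}\mathbf{z}\cdot\mathbf{t}_i\,ds=v_i,\qquad i=1,2,3.$$
   Context: $\Gamma_h^T$ is a segment whose endpoints are two distinct points lying on two different edges of $T$, and which divides $T$ into two polygons $T_h^-$, $T_h^+$ with nonempty interior. $\bar{\mathbf{t}}$ and $\bar{\mathbf{n}}$ are unit tangential and normal vectors to $\Gamma_h^T$, and $X_m$ is its midpoint. For a vector field $\mathbf{v}=[v_1,v_2]^t$, $\mathrm{curl}\,\mathbf{v}=\partial_{x_1}v_2-\partial_{x_2}v_1$. For a set $K$, $\mathcal{ND}_h(K)=\{\mathbf{a}+b[x_2,-x_1]^t:\mathbf{a}\in\mathbb{R}^2,\ b\in\mathbb{R}\}$ (functions on $K$), the lowest order first-family Nédélec space. $\mathcal{C}_T:\mathcal{ND}_h(T_h^-)\to\mathcal{ND}_h(T_h^+)$ is the linear operator determined by $\mathcal{C}_T(\mathbf{v}_h)\cdot\bar{\mathbf{t}}=\mathbf{v}_h\cdot\bar{\mathbf{t}}$, $\ \frac{1}{\mu^+}\mathrm{curl}\,\mathcal{C}_T(\mathbf{v}_h)=\frac{1}{\mu^-}\mathrm{curl}\,\mathbf{v}_h$,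 $\ \beta^+\mathcal{C}_T(\mathbf{v}_h)\cdot\bar{\mathbf{n}}=\beta^-\mathbf{v}_h\cdot\bar{\mathbf{n}}$, all imposed at $X_m$ (it is well defined). The local immersed finite element (IFE) space is $\mathcal{IND}_h(T)=\{\mathbf{z}_h:\ \mathbf{z}_h=\mathbf{v}_h\text{ on }T_h^-,\ \mathbf{z}_h=\mathcal{C}_T(\mathbf{v}_h)\text{ on }T_h^+,\ \mathbf{v}_h\in\mathcal{ND}_h(T_h^-)\}$. *)

(* Defs.v *)
From Stdlib Require Import Reals Lra ClassicalEpsilon.
From Coquelicot Require Import Coquelicot.
Open Scope R_scope.

Definition R2 : Type := (R * R)%type.

Definition dot (u w : R2) : R := fst u * fst w + snd u * snd w.

(* The Coquelicot [norm] on [R * R] is the Euclidean norm. *)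
Definition angle (u w : R2) : R := acos (dot u w / (norm u * norm w)).

Definition lerp (P Q : R2) (s : R) : R2 := plus (scal (1 - s) P) (scal s Q).

Definition on_segment (P Q x : R2) : Prop :=
  exists s : R, 0 <= s <= 1 /\ x = lerp P Q s.

Definition unit_tangent (P Q t : R2) : Prop :=
  norm t = 1 /\ exists c : R, minus Q P = scal c t.

Definition unit_normal (P Q n : R2) : Prop :=
  norm n = 1 /\ dot n (minus Q P) = 0.

(* Riemann integral of f over the segment PQ with respect to arc length; the
   proposition includes integrability. *)
Definition is_arc_integral (P Q : R2) (f : R2 -> R) (I : R) : Prop :=
  is_RInt (fun s => f (lerp P Q s) * norm (minus Q P)) 0 1 I.

Inductive idx : Set := I1 | I2 | I3.

Definition next (i : idx) : idx :=
  match i with I1 => I2 | I2 => I3 | I3 => I1 end.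

(* A triangle is given by its vertices A : idx -> R2. The i-th edge is the one
   opposite to the i-th vertex. *)
Definition edge_start (A : idx -> R2) (i : idx) : R2 := A (next i).
Definition edge_end (A : idx -> R2) (i : idx) : R2 := A (next (next i)).

Definition on_edge (A : idx -> R2) (i : idx) (x : R2) : Prop :=
  on_segment (edge_start A i) (edge_end A i) x.

Definition nondegenerate (A : idx -> R2) : Prop :=
  forall b c : R,
    plus (scal b (minus (A I2) (A I1))) (scal c (minus (A I3) (A I1))) = zero ->
    b = 0 /\ c = 0.

Definition no_obtuse_angle (A : idx -> R2) : Prop :=
  forall i : idx,
    angle (minus (A (next i)) (A i)) (minus (A (next (next i))) (A i)) <= PI / 2.

Definition in_triangle (A : idx -> R2) (x : R2) : Prop :=
  exists l : idx -> R,
    (forall i, 0 <= l i) /\ l I1 + l I2 + l I3 = 1 /\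
    x = plus (scal (l I1) (A I1)) (plus (scal (l I2) (A I2)) (scal (l I3) (A I3))).

Definition has_interior (S : R2 -> Prop) : Prop := exists x : R2, locally x S.

(* Tm and Tp are the two parts into which the segment DE, with endpoints on two
   different edges, divides the triangle. They are taken without their common
   side DE, on which the piecewise fields below are two-valued. The vector nu
   may point either way, so either part may be called Tm. *)
Definition divides (A : idx -> R2) (D E : R2) (Tm Tp : R2 -> Prop) : Prop :=
  D <> E /\
  (exists i j : idx, i <> j /\ on_edge A i D /\ on_edge A j E) /\
  (exists nu : R2, nu <> zero /\ dot nu (minus E D) = 0 /\
     (forall x, Tm x <-> in_triangle A x /\ dot nu (minus x D) < 0) /\
     (forall x, Tp x <-> in_triangle A x /\ 0 < dot nu (minus x D))) /\
  has_interior Tm /\ has_interior Tp.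

Definition curl (v : R2 -> R2) (x : R2) : R :=
  Derive (fun s => snd (v (s, snd x))) (fst x)
  - Derive (fun s => fst (v (fst x, s))) (snd x).

(* An element of the Nedelec space on a set K with nonempty interior is
   represented by its unique extension of the same form to the plane; this gives
   a meaning to its value and curl at points of the boundary of K. *)
Definition ND (v : R2 -> R2) : Prop :=
  exists (a : R2) (b : R), forall x : R2, v x = plus a (scal b (snd x, - fst x)).

Definition is_CT (mum mup bm bp : R) (t n X : R2) (v w : R2 -> R2) : Prop :=
  ND w /\
  dot (w X) t = dot (v X) t /\
  / mup * curl w X = / mum * curl v X /\
  bp * dot (w X) n = bm * dot (v X) n.

Definition CT (mum mup bm bp : R) (t n X : R2) (v : R2 -> R2) : R2 -> R2 :=
  epsilon (inhabits (fun x => x)) (is_CT mum mup bm bp t n X v).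

Definition IND (mum mup bm bp : R) (D E t n : R2) (Tm Tp : R2 -> Prop)
    (z : R2 -> R2) : Prop :=
  exists v : R2 -> R2, ND v /\
    (forall x, Tm x -> z x = v x) /\
    (forall x, Tp x -> z x = CT mum mup bm bp t n (lerp D E (1 / 2)) v x).

Lemma norm_unit (u : R2) : norm u = 1 -> fst u * fst u + snd u * snd u = 1.
Proof.
destruct u as [a b]; intros H.
change (sqrt (Rabs a * (Rabs a * 1) + Rabs b * (Rabs b * 1)) = 1) in H.
rewrite !Rmult_1_r, <- !Rabs_mult, !Rabs_pos_eq in H by nra.
cbn. rewrite <- (sqrt_sqrt (a * a + b * b)) by nra. rewrite H; ring.
Qed.

Lemma curl_ND (v : R2 -> R2) (a : R2) (b : R) (X : R2) :
  (forall x : R2, v x = plus a (scal b (snd x, - fst x))) ->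
  curl v X = -2 * b.
Proof.
intros Hv; unfold curl.
rewrite (Derive_ext _ (fun s => snd a + b * - s))
  by (intros s; rewrite Hv; reflexivity).
rewrite (Derive_ext (fun s => fst (v (fst X, s))) (fun s => fst a + b * s))
  by (intros s; rewrite Hv; reflexivity).
rewrite (is_derive_unique (fun s => snd a + b * - s) _ (- b))
  by (auto_derive; [trivial | ring]).
rewrite (is_derive_unique (fun s => fst a + b * s) _ b)
  by (auto_derive; [trivial | ring]).
ring.
Qed.

Lemma is_CT_exists (mum mup bm bp : R) (t n X : R2) (v : R2 -> R2) :
  0 < mum -> 0 < mup -> 0 < bm -> 0 < bp ->
  norm t = 1 -> norm n = 1 -> dot n t = 0 ->
  ND v -> exists w, is_CT mum mup bm bp t n X v w.
Proof.
intros hmum hmup hbm hbp ht hn hnt.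
intros [a [b Hv]].
pose proof (norm_unit t ht) as Ht. pose proof (norm_unit n hn) as Hn.
pose proof hnt as Hnt; cbv [dot] in Hnt.
set (p := dot (v X) t). set (q := bm / bp * dot (v X) n).
set (b' := mup / mum * b).
exists (fun x => plus (plus (scal p t) (plus (scal q n)
                   (scal (- b') (snd X, - fst X)))) (scal b' (snd x, - fst x))).
repeat split.
- exists (plus (scal p t) (plus (scal q n) (scal (- b') (snd X, - fst X)))), b'.
  reflexivity.
- fold p. clearbody p q b'. destruct t as [t1 t2], n as [n1 n2], X as [x1 x2].
  unfold dot in *; cbn in *; unfold plus, scal in *; cbn in *.
  unfold plus, mult in *; cbn in *.
  transitivity (p * (t1 * t1 + t2 * t2) + q * (n1 * t1 + n2 * t2));
    [ring | rewrite Ht, Hnt; ring].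
- erewrite (curl_ND _ _ b') by reflexivity. rewrite (curl_ND _ _ _ _ Hv).
  unfold b'; field; lra.
- replace (bm * dot (v X) n) with (bp * q) by (unfold q; field; lra).
  f_equal. clearbody p q b'. destruct t as [t1 t2], n as [n1 n2], X as [x1 x2].
  unfold dot in *; cbn in *; unfold plus, scal in *; cbn in *.
  unfold plus, mult in *; cbn in *.
  transitivity (q * (n1 * n1 + n2 * n2) + p * (n1 * t1 + n2 * t2));
    [ring | rewrite Hn, Hnt; ring].
Qed.

Lemma CT_spec (mum mup bm bp : R) (t n X : R2) (v : R2 -> R2) :
  0 < mum -> 0 < mup -> 0 < bm -> 0 < bp ->
  norm t = 1 -> norm n = 1 -> dot n t = 0 ->
  ND v -> is_CT mum mup bm bp t n X v (CT mum mup bm bp t n X v).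
Proof. intros; unfold CT; apply epsilon_spec, is_CT_exists; assumption. Qed.

Lemma is_CT_unique (mum mup bm bp : R) (t n X : R2) (v w w' : R2 -> R2) :
  0 < mum -> 0 < mup -> 0 < bm -> 0 < bp ->
  norm t = 1 -> norm n = 1 -> dot n t = 0 ->
  is_CT mum mup bm bp t n X v w -> is_CT mum mup bm bp t n X v w' ->
  forall x, w x = w' x.
Proof.
intros hmum hmup hbm hbp ht hn hnt.
intros [[a [b Hw]] [H1 [H2 H3]]] [[a' [b' Hw']] [H1' [H2' H3']]] x.
rewrite (curl_ND _ _ _ _ Hw) in H2. rewrite (curl_ND _ _ _ _ Hw') in H2'.
assert (Hb : b = b').
{ rewrite <- H2' in H2. apply Rmult_eq_reg_l in H2; [lra |].
  apply Rinv_neq_0_compat; lra. }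
subst b'. rewrite <- H1' in H1. rewrite <- H3' in H3.
apply Rmult_eq_reg_l in H3; [| lra].
pose proof (norm_unit t ht) as Ht. pose proof (norm_unit n hn) as Hn.
pose proof hnt as Hnt; cbv [dot] in Hnt.
rewrite Hw, Hw' in H1, H3. rewrite Hw, Hw'. f_equal.
clear - Ht Hn Hnt H1 H3.
destruct t as [t1 t2], n as [n1 n2], X as [x1 x2], a as [a1 a2], a' as [c1 c2].
unfold dot in *; cbn in *; unfold plus, scal, mult in *; cbn in *.
assert (E1 : (a1 - c1) * t1 + (a2 - c2) * t2 = 0) by lra.
assert (E2 : (a1 - c1) * n1 + (a2 - c2) * n2 = 0) by lra.
assert (Dt : (t1 * n2 - t2 * n1) * (t1 * n2 - t2 * n1) = 1).
{ transitivity ((t1 * t1 + t2 * t2) * (n1 * n1 + n2 * n2)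
                - (n1 * t1 + n2 * t2) * (n1 * t1 + n2 * t2)); [ring |].
  rewrite Ht, Hn, Hnt; ring. }
assert (Dn : t1 * n2 - t2 * n1 <> 0) by (intros H; rewrite H in Dt; lra).
assert (F1 : (t1 * n2 - t2 * n1) * (a1 - c1) = 0).
{ transitivity (n2 * ((a1 - c1) * t1 + (a2 - c2) * t2)
                - t2 * ((a1 - c1) * n1 + (a2 - c2) * n2)); [ring |].
  rewrite E1, E2; ring. }
assert (F2 : (t1 * n2 - t2 * n1) * (a2 - c2) = 0).
{ transitivity (t1 * ((a1 - c1) * n1 + (a2 - c2) * n2)
                - n1 * ((a1 - c1) * t1 + (a2 - c2) * t2)); [ring |].
  rewrite E1, E2; ring. }
apply Rmult_integral in F1; apply Rmult_integral in F2.
f_equal; [destruct F1 | destruct F2]; lra.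
Qed.

Lemma ND_lin (k : R) (v u : R2 -> R2) :
  ND v -> ND u -> ND (fun x => plus (scal k (v x)) (u x)).
Proof.
intros [a [b Hv]] [c [d Hu]].
exists (plus (scal k a) c), (k * b + d); intros [x1 x2]; rewrite Hv, Hu.
destruct a as [a1 a2], c as [c1 c2].
apply injective_projections; cbn; unfold plus, scal; cbn; unfold plus, mult; cbn;
  ring.
Qed.

Lemma curl_lin (k : R) (v u : R2 -> R2) (X : R2) :
  ND v -> ND u ->
  curl (fun x => plus (scal k (v x)) (u x)) X = k * curl v X + curl u X.
Proof.
intros [a [b Hv]] [c [d Hu]].
rewrite (curl_ND v _ _ X Hv), (curl_ND u _ _ X Hu).
rewrite (curl_ND _ (plus (scal k a) c) (k * b + d)); [ring |].
intros [x1 x2]; rewrite Hv, Hu. destruct a as [a1 a2], c as [c1 c2].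
apply injective_projections; cbn; unfold plus, scal; cbn; unfold plus, mult; cbn;
  ring.
Qed.

Lemma dot_lin (k : R) (a c w : R2) :
  dot (plus (scal k a) c) w = k * dot a w + dot c w.
Proof.
destruct a as [a1 a2], c as [c1 c2], w as [w1 w2].
unfold dot; cbn; unfold scal, plus; cbn; unfold mult; cbn; ring.
Qed.

Lemma CT_linear (mum mup bm bp : R) (t n X : R2) (k : R) (v u : R2 -> R2) :
  0 < mum -> 0 < mup -> 0 < bm -> 0 < bp ->
  norm t = 1 -> norm n = 1 -> dot n t = 0 ->
  ND v -> ND u ->
  forall x, CT mum mup bm bp t n X (fun y => plus (scal k (v y)) (u y)) x
    = plus (scal k (CT mum mup bm bp t n X v x)) (CT mum mup bm bp t n X u x).
Proof.
intros hmum hmup hbm hbp ht hn hnt Hv Hu.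
pose proof (CT_spec mum mup bm bp t n X v hmum hmup hbm hbp ht hn hnt Hv)
  as [V0 [V1 [V2 V3]]].
pose proof (CT_spec mum mup bm bp t n X u hmum hmup hbm hbp ht hn hnt Hu)
  as [U0 [U1 [U2 U3]]].
apply (is_CT_unique mum mup bm bp t n X (fun y => plus (scal k (v y)) (u y)));
  try assumption.
- apply CT_spec; try assumption. apply ND_lin; assumption.
- split; [apply ND_lin; assumption |].
  rewrite !dot_lin, !curl_lin by assumption.
  repeat split.
  + rewrite V1, U1; reflexivity.
  + transitivity (k * (/ mup * curl (CT mum mup bm bp t n X v) X)
                  + / mup * curl (CT mum mup bm bp t n X u) X); [ring |].
    rewrite V2, U2; ring.
  + transitivity (k * (bp * dot (CT mum mup bm bp t n X v X) n)
                  + bp * dot (CT mum mup bm bp t n X u X) n); [ring |].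
    rewrite V3, U3; ring.
Qed.

(* Main.v *)
Require Import Defs.
From Stdlib Require Import Reals Lra.
From Coquelicot Require Import Coquelicot.
Open Scope R_scope.

(* On both sides of the interface a field of the immersed space is
   p t + (q / beta) nu + c mu R(x - X), with X the midpoint of DE, R the rotation by
   -pi/2, nu normal to DE, and parameters p, q, c common to the two sides. The part
   with p and q is the gradient of a continuous piecewise linear potential, whose
   value at x is p s(x) + q kink(r(x)), where s and r are coordinates along and
   across the interface and kink has slope 1/beta on each side; so its edge
   integrals are differences of vertex values and sum to zero around the triangle. The
   rotational part contributes c times edge terms
   which, as X lies in the triangle, all have the same sign: their sum is nonzero
   and determines c. It remains to see that the images (s, kink r) of the vertices
   are not collinear, and this is where the absence of obtuse angles is used. *)

(** * Planar vectors, norms and angles *)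

Ltac coords :=
  repeat match goal with x : R2 |- _ => destruct x | x : (R * R)%type |- _ => destruct x end;
  unfold dot, lerp, minus in *; cbn in *;
  unfold plus, scal, opp, zero, mult in *; cbn in *;
  unfold plus, scal, opp, zero, mult in *; cbn in *.

Ltac vector_eq := apply injective_projections; coords; ring.

Lemma dot_self_pos (y : R2) : y <> zero -> 0 < dot y y.
Proof.
destruct y as [y1 y2]; unfold dot; cbn; intros H.
destruct (Req_dec y1 0) as [-> | H1]; [| nra].
destruct (Req_dec y2 0) as [-> | H2]; [| nra].
now elim H.
Qed.

Lemma norm_dot (y : R2) : norm y = sqrt (dot y y).
Proof.
destruct y as [a b].
change (sqrt (Rabs a * (Rabs a * 1) + Rabs b * (Rabs b * 1)) = sqrt (a * a + b * b)).
rewrite !Rmult_1_r, <- !Rabs_mult, !Rabs_pos_eq by nra; reflexivity.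
Qed.

Lemma acute_dot_pos (u w : R2) : angle u w <= PI / 2 -> 0 <= dot u w.
Proof.
unfold angle; intros H.
destruct (Rle_or_lt 0 (dot u w)) as [H0 | H0]; [exact H0 | exfalso].
assert (Hu : forall y, 0 <= norm y) by (intros y; rewrite norm_dot; apply sqrt_pos).
assert (Hp : 0 < norm u * norm w).
{ destruct (Rle_lt_or_eq_dec _ _ (Rmult_le_pos _ _ (Hu u) (Hu w))) as [Hp | Hp]; [exact Hp |].
  exfalso; symmetry in Hp; apply Rmult_integral in Hp.
  assert (Hz : u = zero \/ w = zero)
    by (destruct Hp as [Hp | Hp]; [left | right];
      apply (norm_eq_zero (V := prod_NormedModule _ R_NormedModule R_NormedModule) _ Hp)).
  destruct Hz as [-> | ->]; revert H0; unfold dot, zero; cbn; unfold zero; cbn; lra. }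
set (x := dot u w / (norm u * norm w)) in *.
assert (Hx : x < 0) by (apply Rdiv_neg_pos; assumption).
pose proof PI_RGT_0 as HPI. pose proof (acos_bound x) as Hb.
destruct (Rle_or_lt x (-1)) as [H1 | H1].
(* [acos] is constantly [PI] at and below -1, so no Cauchy-Schwarz bound on the quotient is
   involved. *)
- unfold acos in H; destruct (Rle_dec x (-1)); lra.
- pose proof (cos_acos x ltac:(lra)). pose proof (cos_ge_0 (acos x)). lra.
Qed.

(** * Integrals of functions with one jump *)

Definition kink (k l r : R) : R := k * Rmin r 0 + l * Rmax r 0.

Lemma kink_neg (k l r : R) : r <= 0 -> kink k l r = k * r.
Proof. intros H; unfold kink; rewrite Rmin_left, Rmax_right by lra; ring. Qed.

Lemma kink_pos (k l r : R) : 0 <= r -> kink k l r = l * r.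
Proof. intros H; unfold kink; rewrite Rmin_right, Rmax_left by lra; ring. Qed.

(** The value at [h] is left free because a field of the immersed space is unconstrained on the
    cut. *)
Lemma is_RInt_two_steps (f : R -> R) (h a b : R) :
  0 <= h <= 1 ->
  (forall s, 0 < s < h -> f s = a) -> (forall s, h < s < 1 -> f s = b) ->
  is_RInt f 0 1 (h * a + (1 - h) * b).
Proof.
intros Hh Ha Hb.
apply (is_RInt_Chasles f 0 h 1 (h * a) ((1 - h) * b)).
- apply (is_RInt_ext (fun _ => a)).
  + intros s; rewrite Rmin_left, Rmax_right by lra; intros Hs; symmetry; auto.
  + replace (h * a) with (scal (h - 0) a) by (unfold scal; cbn; unfold mult; cbn; ring).
    apply (is_RInt_const (V := R_NormedModule)).
- apply (is_RInt_ext (fun _ => b)).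
  + intros s; rewrite Rmin_left, Rmax_right by lra; intros Hs; symmetry; auto.
  + apply (is_RInt_const (V := R_NormedModule)).
Qed.

(* [h] is the fraction of the segment on which the affine function is negative. *)
Lemma is_RInt_sign_step (r0 r1 : R) :
  r0 <> 0 \/ r1 <> 0 ->
  exists h, 0 <= h <= 1 /\
    (forall (f : R -> R) (a b : R),
       (forall s, 0 <= s <= 1 -> r0 + s * (r1 - r0) < 0 -> f s = a) ->
       (forall s, 0 <= s <= 1 -> 0 < r0 + s * (r1 - r0) -> f s = b) ->
       is_RInt f 0 1 (h * a + (1 - h) * b)) /\
    (forall k l, (r1 - r0) * (h * k + (1 - h) * l) = kink k l r1 - kink k l r0).
Proof.
intros H.
destruct (Rle_or_lt r0 0) as [H0 | H0]; destruct (Rle_or_lt r1 0) as [H1 | H1].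
- exists 1; split; [lra | split].
  + intros f a b Ha Hb. apply is_RInt_two_steps; [lra | | intros; lra].
    (* Two nonpositive end values that are not both 0 give strict negativity for [0 < s < 1]. *)
    intros s Hs; apply Ha; [lra |]. nra.
  + intros k l; rewrite !kink_neg by lra; ring.
- assert (Hh : 0 <= - r0 / (r1 - r0) <= 1).
  { split; [apply Rdiv_le_0_compat; lra | apply Rle_div_l; lra]. }
  assert (Eh : - r0 / (r1 - r0) * (r1 - r0) = - r0) by (field; lra).
  exists (- r0 / (r1 - r0)); split; [exact Hh | split].
  + intros f a b Ha Hb. apply is_RInt_two_steps; [exact Hh | |];
      intros s Hs; [apply Ha | apply Hb]; nra.
  + intros k l; rewrite kink_pos, kink_neg by lra; field; lra.
- assert (Hh : 0 <= r0 / (r0 - r1) <= 1).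
  { split; [apply Rdiv_le_0_compat; lra | apply Rle_div_l; lra]. }
  assert (Eh : r0 / (r0 - r1) * (r0 - r1) = r0) by (field; lra).
  (* The positive piece comes first here, so [h] is the complement of the zero of the affine
     function. *)
  exists (1 - r0 / (r0 - r1)); split; [lra | split].
  + intros f a b Ha Hb.
    replace ((1 - r0 / (r0 - r1)) * a + (1 - (1 - r0 / (r0 - r1))) * b)
      with (r0 / (r0 - r1) * b + (1 - r0 / (r0 - r1)) * a) by ring.
    apply is_RInt_two_steps; [exact Hh | |];
      intros s Hs; [apply Hb | apply Ha]; nra.
  + intros k l; rewrite kink_neg, (kink_pos _ _ r0) by lra; field; lra.
- exists 0; split; [lra | split].
  + intros f a b Ha Hb. apply is_RInt_two_steps; [lra | intros; lra |].
    intros s Hs; apply Hb; [lra |]. nra.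
  + intros k l; rewrite !kink_pos by lra; ring.
Qed.

(** * One-sided fields and their edge moments *)

Definition rot (x : R2) : R2 := (snd x, - fst x).

(** [k] and [m] are the beta and mu of one side. For [nu] orthogonal to [t], the quantities that
    [CT] preserves at [X] depend only on [p], [q], [c]. *)
Definition ife_side (t nu X : R2) (k m p q c : R) (x : R2) : R2 :=
  plus (plus (scal p t) (scal (q / k) nu)) (scal (m * c) (rot (minus x X))).

(** Moving along the edge adds a multiple of [minus Q P], whose rotation is orthogonal to the edge;
    hence [s] drops out. *)
Lemma ife_side_dot_edge (t nu X P Q : R2) (k m p q c s : R) :
  dot (ife_side t nu X k m p q c (lerp P Q s)) (minus Q P)
  = p * dot t (minus Q P) + q / k * dot nu (minus Q P)
    + m * c * dot (rot (minus P X)) (minus Q P).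
Proof. unfold ife_side, rot; coords; ring. Qed.

Lemma dot_lerp (nu D P Q : R2) (s : R) :
  dot nu (minus (lerp P Q s) D)
  = dot nu (minus P D) + s * (dot nu (minus Q D) - dot nu (minus P D)).
Proof. coords; ring. Qed.

(* The sign [e] compares [te] with the direction from [P] to [Q]. The rotational
   part of the field has constant dot product with the edge on each side, so its
   jump enters only through the fraction [h] of the edge lying on the first side;
   the normal parts add up to an increment of [kink]. *)
Lemma edge_moment (P Q te D nu : R2) :
  unit_tangent P Q te -> minus Q P <> zero ->
  dot nu (minus P D) <> 0 \/ dot nu (minus Q D) <> 0 ->
  exists e h, e * e = 1 /\ 0 <= h <= 1 /\
    forall (t X : R2) (k k' m m' p q c : R) (z : R2 -> R2),
      (forall s, 0 <= s <= 1 -> dot nu (minus (lerp P Q s) D) < 0 ->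
         z (lerp P Q s) = ife_side t nu X k m p q c (lerp P Q s)) ->
      (forall s, 0 <= s <= 1 -> 0 < dot nu (minus (lerp P Q s) D) ->
         z (lerp P Q s) = ife_side t nu X k' m' p q c (lerp P Q s)) ->
      is_arc_integral P Q (fun x => dot (z x) te)
        (e * (p * dot t (minus Q P)
              + q * (kink (/ k) (/ k') (dot nu (minus Q D))
                     - kink (/ k) (/ k') (dot nu (minus P D)))
              + c * (dot (rot (minus P X)) (minus Q P) * (h * m + (1 - h) * m')))).
Proof.
intros [Hn [d Hd]] Hne Hr.
destruct (is_RInt_sign_step _ _ Hr) as [h [Hh [Hint Hk]]].
assert (Hd0 : d <> 0).
{ intros ->; apply Hne; rewrite Hd. apply (scal_zero_l te). }
assert (HN : norm (minus Q P) = Rabs d).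
{ assert (H1 := norm_unit te Hn). rewrite norm_dot, Hd, <- sqrt_Rsqr_abs.
  f_equal; unfold Rsqr. rewrite <- (Rmult_1_r (d * d)), <- H1. coords; ring. }
exists (Rabs d / d), h; split; [| split; [exact Hh |]].
{ transitivity (Rabs d * Rabs d / (d * d)); [field; exact Hd0 |].
  rewrite <- Rabs_mult, Rabs_pos_eq by nra. field; exact Hd0. }
intros t X k k' m m' p q c z Hm Hp.
(* Up to the sign of [d], the unit tangent times the length is the edge vector. *)
assert (Hdot : forall y, dot y te * Rabs d = Rabs d / d * dot y (minus Q P)).
{ intros y; rewrite Hd.
  replace (dot y (scal d te)) with (d * dot y te) by (coords; ring).
  field; exact Hd0. }
unfold is_arc_integral; rewrite HN.
set (w := dot (rot (minus P X)) (minus Q P)).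
assert (Hz : is_RInt (fun s => dot (z (lerp P Q s)) te * Rabs d) 0 1
  (h * (Rabs d / d * (p * dot t (minus Q P) + q / k * dot nu (minus Q P) + m * c * w))
   + (1 - h) * (Rabs d / d * (p * dot t (minus Q P) + q / k' * dot nu (minus Q P)
                              + m' * c * w)))).
{ apply Hint; intros s Hs Hs'; rewrite Hdot; rewrite <- dot_lerp in Hs'.
  - rewrite (Hm s Hs Hs'), ife_side_dot_edge; reflexivity.
  - rewrite (Hp s Hs Hs'), ife_side_dot_edge; reflexivity. }
refine (eq_ind _ (is_RInt _ 0 1) Hz _ _).
rewrite <- Hk.
replace (dot nu (minus Q D) - dot nu (minus P D)) with (dot nu (minus Q P))
  by (coords; ring).
unfold Rdiv; generalize (Rabs d * / d); intros e.
match goal with |- ?x = ?y => change (@eq R x y) end. ring.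
Qed.

(** * Non-collinearity of the vertex images *)

(* Unisolvence of the piecewise linear immersed potentials at the vertices. Multiplied
   by [a * b * d], the determinant is [r] times a combination, with weights [k] and [l]
   in some order, of [a * b * N1] and [N2] below; both are nonnegative when the
   triangle has no obtuse angle, and they sum to [|scal d t|^2 > 0]. *)
Lemma kinked_det (u w t nu : R2) (a b r d k l : R) :
  0 < a <= 1 -> 0 < b <= 1 -> 0 < k -> 0 < l -> r <> 0 ->
  r + a * dot nu u = 0 -> r + b * dot nu w = 0 ->
  0 <= dot u w <= dot u u -> dot u w <= dot w w ->
  minus (scal b w) (scal a u) = scal d t -> scal d t <> zero ->
  dot t u * (kink k l (r + dot nu w) - kink k l r)
  - dot t w * (kink k l (r + dot nu u) - kink k l r) <> 0.
Proof.
intros Ha Hb Hk Hl Hr Hu Hw Huw Hww Hd Hd0.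
set (U := dot u u) in *; set (W := dot w w) in *; set (V := dot u w) in *.
assert (Etu : d * dot t u = b * V - a * U).
{ transitivity (dot (scal d t) u); [coords; ring |].
  rewrite <- Hd; unfold U, V; coords; ring. }
assert (Etw : d * dot t w = b * W - a * V).
{ transitivity (dot (scal d t) w); [coords; ring |].
  rewrite <- Hd; unfold W, V; coords; ring. }
assert (Hpos : 0 < b * b * W + a * a * U - 2 * (a * b) * V).
{ replace (b * b * W + a * a * U - 2 * (a * b) * V) with (dot (scal d t) (scal d t))
    by (rewrite <- Hd; unfold U, V, W; coords; ring).
  apply dot_self_pos, Hd0. }
set (N1 := b * (W - V) + a * (U - V)).
set (N2 := (1 - a) * (b * (b * W - a * V)) + (1 - b) * (a * (a * U - b * V))).
assert (H1 : 0 <= N1) by (unfold N1; nra).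
assert (H2 : 0 <= N2).
(* Every summand is nonnegative, since [V], [U - V] and [W - V] are: one condition for each angle of
   the triangle. *)
{ replace N2 with ((1 - a) * (b * b) * (W - V) + (1 - b) * (a * a) * (U - V)
    + V * ((b - a) * (b - a))) by (unfold N2; ring).
  assert (Hs : 0 <= (b - a) * (b - a)) by apply Rle_0_sqr.
  apply Rplus_le_le_0_compat; [| apply Rmult_le_pos; lra].
  apply Rplus_le_le_0_compat; repeat apply Rmult_le_pos; lra. }
assert (H12 : 0 < a * b * N1 + N2).
{ replace (a * b * N1 + N2) with (b * b * W + a * a * U - 2 * (a * b) * V)
    by (unfold N1, N2; ring). exact Hpos. }
assert (Hab : 0 < a * b) by nra.
assert (HabN : 0 <= a * b * N1) by nra.
assert (Hcomb : forall x y, 0 < x -> 0 < y -> 0 < x * (a * b * N1) + y * N2).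
{ intros x y Hx Hy. destruct (Rle_or_lt x y); nra. }
assert (Eu : a * (r + dot nu u) = - (1 - a) * r) by lra.
assert (Ew : b * (r + dot nu w) = - (1 - b) * r) by lra.
intros H0.
(* [x] is the slope on the corner's side and [y] the other one: by [Eu] and [Ew] the two other
   vertices lie on the cut line or beyond it. *)
assert (Hg : forall x y,
  dot t u * (y * (r + dot nu w) - x * r) - dot t w * (y * (r + dot nu u) - x * r) = 0 ->
  0 < x -> 0 < y -> False).
{ intros x y H Hx Hy. specialize (Hcomb x y Hx Hy).
  apply Hr. apply (Rmult_eq_reg_r (x * (a * b * N1) + y * N2)); [| lra].
  rewrite Rmult_0_l, <- (Rmult_0_r (a * b * d)), <- H.
  transitivity (a * ((d * dot t u) * (y * (b * (r + dot nu w)) - b * (x * r)))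
    - b * ((d * dot t w) * (y * (a * (r + dot nu u)) - a * (x * r)))); [| ring].
  rewrite Etu, Etw, Eu, Ew. unfold N1, N2; ring. }
destruct (Rtotal_order r 0) as [Hr' | [Hr' | Hr']]; [| now elim Hr |].
- rewrite (kink_neg _ _ r), !kink_pos in H0 by nra. eauto.
- rewrite (kink_pos _ _ r), !kink_neg in H0 by nra. eauto.
Qed.

Lemma on_segment_sym (P Q x : R2) : on_segment P Q x -> on_segment Q P x.
Proof.
intros [s [Hs ->]]; exists (1 - s); split; [lra |].
vector_eq.
Qed.

(** [P] is the common vertex of the two cut edges. With [u] and [w] the edges leaving [P], the angle
    conditions at [P], [U], [W] become the bounds on [dot u w] in [kinked_det]. *)
Lemma corner_det (P U W D E t nu : R2) (d k l : R) :
  on_segment P U D -> on_segment P W E ->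
  minus E D = scal d t -> minus E D <> zero -> dot nu (minus E D) = 0 ->
  0 < k -> 0 < l ->
  0 <= dot (minus U P) (minus W P) -> 0 <= dot (minus P U) (minus W U) ->
  0 <= dot (minus P W) (minus U W) ->
  dot nu (minus P D) <> 0 \/ dot nu (minus U D) <> 0 ->
  dot nu (minus P D) <> 0 \/ dot nu (minus W D) <> 0 ->
  dot t (minus U P)
    * (kink k l (dot nu (minus W D)) - kink k l (dot nu (minus P D)))
  - dot t (minus W P)
    * (kink k l (dot nu (minus U D)) - kink k l (dot nu (minus P D))) <> 0.
Proof.
intros [a [Ha HD]] [b [Hb HE]] Hd Hne HnuE Hk Hl HP HU HW HPU HPW.
set (rP := dot nu (minus P D)) in *.
assert (ErU : dot nu (minus U D) = rP + dot nu (minus U P)) by (unfold rP; coords; ring).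
assert (ErW : dot nu (minus W D) = rP + dot nu (minus W P)) by (unfold rP; coords; ring).
assert (EU : rP + a * dot nu (minus U P) = 0).
{ unfold rP; rewrite HD; coords; ring. }
assert (EW : rP + b * dot nu (minus W P) = 0).
{ transitivity (dot nu (minus E D)); [| exact HnuE].
  unfold rP; rewrite HE; coords; ring. }
rewrite ErU, ErW in *.
assert (Hab : a <> 0 \/ b <> 0).
{ destruct (Req_dec a 0) as [-> | ?]; [right | left; assumption].
  intros ->; apply Hne; rewrite HE, HD; vector_eq. }
(* If the cut line passed through [P], then [a] and [b] would both vanish, since neither [U] nor [W]
   would lie on it; but then [D] and [E] coincide. *)
assert (HrP : rP <> 0).
{ intros H0; rewrite H0, !Rplus_0_l in *.
  destruct HPU as [HPU | HPU]; [lra |]; destruct HPW as [HPW | HPW]; [lra |].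
  apply Rmult_integral in EU; apply Rmult_integral in EW; tauto. }
assert (Ha0 : a <> 0) by (intros ->; lra).
assert (Hb0 : b <> 0) by (intros ->; lra).
apply (kinked_det _ _ t nu a b rP d); try assumption; try lra.
- split; [assumption |].
  apply Rminus_le; apply Ropp_le_cancel; rewrite Ropp_0.
  eapply eq_ind; [exact HU | coords; ring].
- apply Rminus_le; apply Ropp_le_cancel; rewrite Ropp_0.
  eapply eq_ind; [exact HW | coords; ring].
- rewrite <- Hd, HE, HD; vector_eq.
- rewrite <- Hd; exact Hne.
Qed.

(** * Parametrization of the immersed space *)

Lemma ND_ife_side (t nu X : R2) (k m p q c : R) : ND (ife_side t nu X k m p q c).
Proof.
exists (minus (plus (scal p t) (scal (q / k) nu)) (scal (m * c) (rot X))), (m * c).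
intros x; unfold ife_side, rot; vector_eq.
Qed.

Lemma curl_ife_side (t nu X Y : R2) (k m p q c : R) :
  curl (ife_side t nu X k m p q c) Y = -2 * (m * c).
Proof.
apply (curl_ND _ (minus (plus (scal p t) (scal (q / k) nu)) (scal (m * c) (rot X)))).
intros x; unfold ife_side, rot; vector_eq.
Qed.

Lemma ife_side_center (t nu X : R2) (k m p q c : R) :
  ife_side t nu X k m p q c X = plus (scal p t) (scal (q / k) nu).
Proof. unfold ife_side, rot; vector_eq. Qed.

Lemma orthogonal_expansion (t nu y : R2) :
  norm t = 1 -> nu <> zero -> dot nu t = 0 ->
  y = plus (scal (dot y t) t) (scal (dot y nu / dot nu nu) nu).
Proof.
intros Ht Hnu Hort; apply norm_unit in Ht.
assert (Hnn : dot nu nu <> 0).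
{ apply Rgt_not_eq, dot_self_pos, Hnu. }
(* In the plane [nu] is a multiple of [t] turned by a right angle. *)
assert (He : exists e, nu = scal e (- snd t, fst t)).
{ exists (snd nu * fst t - fst nu * snd t).
  destruct t as [a b], nu as [f g]; unfold dot in Hort; cbn in Ht, Hort.
  apply injective_projections; coords.
  - transitivity (f * (a * a + b * b) - a * (f * a + g * b));
      [rewrite Ht, Hort; ring | ring].
  - transitivity (g * (a * a + b * b) - b * (f * a + g * b));
      [rewrite Ht, Hort; ring | ring]. }
destruct He as [e ->].
assert (He0 : e <> 0) by (intros ->; apply Hnn; coords; ring).
replace (dot (scal e (- snd t, fst t)) (scal e (- snd t, fst t))) with (e * e)
  by (rewrite <- (Rmult_1_r (e * e)), <- Ht; coords; ring).
clear - Ht He0; destruct t as [a b], y as [y1 y2]; cbn in Ht.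
apply injective_projections; coords.
- transitivity (y1 * (a * a + b * b)); [rewrite Ht; ring | field; exact He0].
- transitivity (y2 * (a * a + b * b)); [rewrite Ht; ring | field; exact He0].
Qed.

Lemma ND_is_ife_side (t nu X : R2) (k m : R) (v : R2 -> R2) :
  norm t = 1 -> nu <> zero -> dot nu t = 0 -> k <> 0 -> m <> 0 -> ND v ->
  exists p q c, forall x, v x = ife_side t nu X k m p q c x.
Proof.
intros Ht Hnu Hort Hk Hm [a [b Hv]].
(* The rotational part vanishes at [X], so [v X] gives [p] and [q]; the coefficient [b] gives
   [c]. *)
exists (dot (v X) t), (k * (dot (v X) nu / dot nu nu)), (b / m); intros x.
unfold ife_side.
replace (k * (dot (v X) nu / dot nu nu) / k) with (dot (v X) nu / dot nu nu)
  by (unfold Rdiv; rewrite (Rmult_comm k), Rmult_assoc, Rinv_r, Rmult_1_r by exact Hk;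
      reflexivity).
rewrite <- orthogonal_expansion by assumption.
replace (m * (b / m)) with b by (field; exact Hm).
rewrite !Hv; unfold rot; vector_eq.
Qed.

(** The three conditions at [X] read off [p], [-2 * c] and [q * dot nu n]; the scalings of [q] and
    [c] are made for this. *)
Lemma CT_ife_side (mum mup bm bp : R) (t n nu X : R2) (p q c : R) :
  0 < mum -> 0 < mup -> 0 < bm -> 0 < bp ->
  norm t = 1 -> norm n = 1 -> dot n t = 0 -> dot nu t = 0 ->
  forall x, CT mum mup bm bp t n X (ife_side t nu X bm mum p q c) x
    = ife_side t nu X bp mup p q c x.
Proof.
intros hmum hmup hbm hbp ht hn hnt hnu.
apply (is_CT_unique mum mup bm bp t n X (ife_side t nu X bm mum p q c)); try assumption.
- apply CT_spec; try assumption. apply ND_ife_side.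
- split; [apply ND_ife_side |].
  rewrite !curl_ife_side, !ife_side_center, !dot_lin.
  replace (dot (scal (q / bp) nu) t) with (q / bp * dot nu t) by (coords; ring).
  replace (dot (scal (q / bm) nu) t) with (q / bm * dot nu t) by (coords; ring).
  replace (dot (scal (q / bp) nu) n) with (q / bp * dot nu n) by (coords; ring).
  replace (dot (scal (q / bm) nu) n) with (q / bm * dot nu n) by (coords; ring).
  replace (dot t n) with (dot n t) by (coords; ring).
  rewrite hnt, hnu; repeat split; field; lra.
Qed.

(** [CT] chooses from a predicate on the function [v]; uniqueness of the chosen field carries
    pointwise equality through. *)
Lemma CT_ext (mum mup bm bp : R) (t n X : R2) (v w : R2 -> R2) :
  0 < mum -> 0 < mup -> 0 < bm -> 0 < bp ->
  norm t = 1 -> norm n = 1 -> dot n t = 0 -> ND v -> ND w ->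
  (forall x, v x = w x) ->
  forall x, CT mum mup bm bp t n X v x = CT mum mup bm bp t n X w x.
Proof.
intros hmum hmup hbm hbp ht hn hnt Hv Hw Hvw.
apply (is_CT_unique mum mup bm bp t n X v); try assumption.
- apply CT_spec; assumption.
- destruct (CT_spec mum mup bm bp t n X w) as [H0 [H1 [H2 H3]]]; try assumption.
  destruct Hv as [a [b Hv]].
  rewrite (curl_ND w a b) in H2 by (intros x; rewrite <- Hvw; apply Hv).
  split; [exact H0 |]. rewrite (curl_ND v a b X Hv), Hvw. auto.
Qed.

(** Eliminates the choice operator: membership becomes three real unknowns, and the theorem a 3 by 3
    linear system. *)
Lemma IND_iff (mum mup bm bp : R) (D E t n nu : R2) (Tm Tp : R2 -> Prop)
    (z : R2 -> R2) :
  0 < mum -> 0 < mup -> 0 < bm -> 0 < bp ->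
  norm t = 1 -> norm n = 1 -> dot n t = 0 -> nu <> zero -> dot nu t = 0 ->
  let X := lerp D E (1 / 2) in
  IND mum mup bm bp D E t n Tm Tp z <->
  exists p q c, (forall x, Tm x -> z x = ife_side t nu X bm mum p q c x) /\
                (forall x, Tp x -> z x = ife_side t nu X bp mup p q c x).
Proof.
intros hmum hmup hbm hbp ht hn hnt hnu hnut X; split.
- intros [v [Hv [Hm Hp]]].
  destruct (ND_is_ife_side t nu X bm mum v) as [p [q [c Hf]]]; try assumption; try lra.
  exists p, q, c; split; intros x Hx.
  + rewrite Hm by exact Hx; apply Hf.
  + rewrite Hp by exact Hx. fold X.
    rewrite (CT_ext mum mup bm bp t n X v (ife_side t nu X bm mum p q c));
      try assumption; [apply CT_ife_side; assumption | apply ND_ife_side].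
- intros [p [q [c [Hm Hp]]]].
  exists (ife_side t nu X bm mum p q c); split; [apply ND_ife_side | split; [exact Hm |]].
  intros x Hx; rewrite Hp by exact Hx; symmetry; apply CT_ife_side; assumption.
Qed.

(** * The linear system for the parameters *)

(* Adding the equations eliminates [p] and [q]. *)
Lemma solve_moments (s g w h : idx -> R) :
  (s I2 - s I1) * (g I3 - g I1) - (s I3 - s I1) * (g I2 - g I1) <> 0 ->
  w I1 + w I2 + w I3 <> 0 ->
  let sys p q c := forall i,
    p * (s (next (next i)) - s (next i)) + q * (g (next (next i)) - g (next i))
    + c * w i = h i in
  exists p q c, sys p q c /\
    forall p' q' c', sys p' q' c' -> p' = p /\ q' = q /\ c' = c.
Proof.
intros Hdet Hw sys.
set (det := (s I2 - s I1) * (g I3 - g I1) - (s I3 - s I1) * (g I2 - g I1)) in *.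
set (c := (h I1 + h I2 + h I3) / (w I1 + w I2 + w I3)).
(* With [c] known, Cramer's rule solves equations [I2] and [I3]; equation [I1] then follows from the
   sum. *)
set (h2 := h I2 - c * w I2). set (h3 := h I3 - c * w I3).
set (p := (h3 * (g I3 - g I1) + h2 * (g I2 - g I1)) / det).
set (q := - (h3 * (s I3 - s I1) + h2 * (s I2 - s I1)) / det).
assert (Ec : c * (w I1 + w I2 + w I3) = h I1 + h I2 + h I3)
  by (unfold c; field; exact Hw).
assert (E2 : p * (s I1 - s I3) + q * (g I1 - g I3) = h2)
  by (unfold p, q; unfold det in *; field; exact Hdet).
assert (E3 : p * (s I2 - s I1) + q * (g I2 - g I1) = h3)
  by (unfold p, q; unfold det in *; field; exact Hdet).
exists p, q, c; split.
- intros []; cbn [next]; unfold h2, h3 in *; lra.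
- intros p' q' c' H.
  pose proof (H I1) as F1; pose proof (H I2) as F2; pose proof (H I3) as F3.
  cbn [next] in F1, F2, F3.
  assert (Hc : c' = c).
  { apply (Rmult_eq_reg_r (w I1 + w I2 + w I3)); [lra | exact Hw]. }
  rewrite Hc in *; repeat split.
  + apply (Rmult_eq_reg_r det); [| exact Hdet].
    transitivity (h3 * (g I3 - g I1) + h2 * (g I2 - g I1));
      [| unfold p; field; exact Hdet].
    unfold h2, h3, det; rewrite <- F2, <- F3; ring.
  + apply (Rmult_eq_reg_r det); [| exact Hdet].
    transitivity (- (h3 * (s I3 - s I1) + h2 * (s I2 - s I1)));
      [| unfold q; field; exact Hdet].
    unfold h2, h3, det; rewrite <- F2, <- F3; ring.
Qed.

(** * Barycentric coordinates and the cut *)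

Lemma on_edge_in_triangle (A : idx -> R2) (i : idx) (x : R2) :
  on_edge A i x -> in_triangle A x.
Proof.
intros [s [Hs ->]]; unfold edge_start, edge_end.
exists (fun j => match i, j with
  | I1, I2 | I2, I3 | I3, I1 => 1 - s
  | I1, I3 | I2, I1 | I3, I2 => s
  | _, _ => 0 end).
repeat split; [intros j; destruct i, j; lra | destruct i; lra |].
destruct i; cbn [next]; vector_eq.
Qed.

Lemma in_triangle_lerp (A : idx -> R2) (P Q : R2) (s : R) :
  0 <= s <= 1 -> in_triangle A P -> in_triangle A Q -> in_triangle A (lerp P Q s).
Proof.
intros Hs [l [Hl [Sl ->]]] [m [Hm [Sm ->]]].
exists (fun i => (1 - s) * l i + s * m i); repeat split.
- intros i; specialize (Hl i); specialize (Hm i); nra.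
- nra.
- vector_eq.
Qed.

(** Up to a common sign these are doubled areas: [X] and edge [i] span the fraction [l i] of the
    triangle. *)
Lemma barycentric_moment (A : idx -> R2) (X : R2) (l : idx -> R) (i : idx) :
  l I1 + l I2 + l I3 = 1 ->
  X = plus (scal (l I1) (A I1)) (plus (scal (l I2) (A I2)) (scal (l I3) (A I3))) ->
  dot (rot (minus (edge_start A i) X)) (minus (edge_end A i) (edge_start A i))
  = l i * dot (rot (minus (A I2) (A I1))) (minus (A I3) (A I1)).
Proof.
intros Hl ->; replace (l I1) with (1 - l I2 - l I3) by lra.
unfold edge_start, edge_end, rot; destruct i; cbn [next];
  replace (l I1) with (1 - l I2 - l I3) by lra; coords; ring.
Qed.

Lemma area_nonzero (A : idx -> R2) :
  nondegenerate A -> dot (rot (minus (A I2) (A I1))) (minus (A I3) (A I1)) <> 0.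
Proof.
unfold nondegenerate, rot.
generalize (minus (A I2) (A I1)) (minus (A I3) (A I1)).
intros [u1 u2] [w1 w2] H H0; unfold dot in H0; cbn in H0.
(* A zero determinant makes [w1 u - u1 w] and [w2 u - u2 w] vanish; independence then kills both
   vectors, which is absurd. *)
assert (Hu1 : w1 = 0 /\ - u1 = 0).
{ apply H; apply injective_projections; coords; lra. }
assert (Hu2 : w2 = 0 /\ - u2 = 0).
{ apply H; apply injective_projections; coords; lra. }
assert (H1 : 1 = 0 /\ 0 = 0).
{ apply H; apply injective_projections; coords; lra. }
lra.
Qed.

Lemma signed_distance (A : idx -> R2) (l : idx -> R) (nu D : R2) :
  l I1 + l I2 + l I3 = 1 ->
  dot nu (minus (plus (scal (l I1) (A I1))
                   (plus (scal (l I2) (A I2)) (scal (l I3) (A I3)))) D)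
  = l I1 * dot nu (minus (A I1) D) + l I2 * dot nu (minus (A I2) D)
    + l I3 * dot nu (minus (A I3) D).
Proof.
intros Hl; replace (l I1) with (1 - l I2 - l I3) by lra; coords; ring.
Qed.

(** With two vertices on the cut line, signed distances inside the triangle are nonnegative
    multiples of the third vertex's, so [x] and [y] could not lie on opposite sides. *)
Lemma cut_misses_edges (A : idx -> R2) (nu D x y : R2) (i j : idx) :
  in_triangle A x -> in_triangle A y ->
  dot nu (minus x D) < 0 -> 0 < dot nu (minus y D) -> i <> j ->
  dot nu (minus (A i) D) <> 0 \/ dot nu (minus (A j) D) <> 0.
Proof.
intros [l [Hl [Sl ->]]] [m [Hm [Sm ->]]] Hx Hy Hij.
rewrite signed_distance in Hx, Hy by assumption.
destruct (Req_dec (dot nu (minus (A i) D)) 0) as [Hi | Hi]; [right | left; exact Hi].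
intros Hj.
assert (Hk : forall k, l k * dot nu (minus (A k) D) < 0 ->
  0 < m k * dot nu (minus (A k) D) -> False).
{ intros k; specialize (Hl k); specialize (Hm k).
  destruct (Rle_or_lt (dot nu (minus (A k) D)) 0); nra. }
destruct i, j; try (now elim Hij); rewrite Hi, Hj in Hx, Hy;
  first [apply (Hk I1); lra | apply (Hk I2); lra | apply (Hk I3); lra].
Qed.

(** * Existence and uniqueness of the interpolating field *)

Theorem theorem3p1
  (A : idx -> R2) (hA : nondegenerate A) (hobt : no_obtuse_angle A)
  (te : idx -> R2)
  (hte : forall i, unit_tangent (edge_start A i) (edge_end A i) (te i))
  (D E : R2) (Tm Tp : R2 -> Prop) (hcut : divides A D E Tm Tp)
  (t n : R2) (ht : unit_tangent D E t) (hn : unit_normal D E n)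
  (mum mup bm bp : R)
  (hmum : 0 < mum) (hmup : 0 < mup) (hbm : 0 < bm) (hbp : 0 < bp)
  (v : idx -> R) :
  exists z : R2 -> R2,
    (IND mum mup bm bp D E t n Tm Tp z /\
     forall i, is_arc_integral (edge_start A i) (edge_end A i)
                 (fun x => dot (z x) (te i)) (v i)) /\
    forall z' : R2 -> R2,
      (IND mum mup bm bp D E t n Tm Tp z' /\
       forall i, is_arc_integral (edge_start A i) (edge_end A i)
                   (fun x => dot (z' x) (te i)) (v i)) ->
      forall x, Tm x \/ Tp x -> z' x = z x.
Proof.
destruct hcut as [hDE [[i0 [j0 [hij [hD hE]]]] [[nu [hnu [hnuE [hTm hTp]]]] [im ip]]]].
destruct im as [xm im]; apply locally_singleton, hTm in im.
destruct ip as [xp ip]; apply locally_singleton, hTp in ip.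
destruct im as [Txm im], ip as [Txp ip].
destruct ht as [ht [d hd]], hn as [hn hnE].
assert (hED : minus E D <> zero).
{ intros H; apply hDE; clear - H.
  pose proof (f_equal fst H) as H1; pose proof (f_equal snd H) as H2; clear H.
  apply injective_projections; coords; lra. }
assert (hd0 : d <> 0).
{ intros ->; apply hED; rewrite hd; vector_eq. }
assert (hort : forall y, dot y (minus E D) = 0 -> dot y t = 0).
{ intros y Hy; apply (Rmult_eq_reg_l d); [| exact hd0].
  rewrite Rmult_0_r, <- Hy, hd; coords; ring. }
pose proof (hort _ hnE) as hnt. pose proof (hort _ hnuE) as hnut.
set (X := lerp D E (1 / 2)).
set (r := fun x => dot nu (minus x D)).
assert (hedge : forall i j, i <> j -> r (A i) <> 0 \/ r (A j) <> 0).
{ intros i j; exact (cut_misses_edges A nu D xm xp i j Txm Txp im ip). }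
pose proof (area_nonzero A hA) as hO.
set (O := dot (rot (minus (A I2) (A I1))) (minus (A I3) (A I1))) in *.
assert (HX : in_triangle A X).
{ apply in_triangle_lerp; [lra | |];
    eapply on_edge_in_triangle; eassumption. }
destruct HX as [l [Hl [Sl EX]]].
(* [e] and [h] precede the parameters and the field, so one linear system serves both existence and
   uniqueness. *)
assert (Hmom : forall i, exists e h, e * e = 1 /\ 0 <= h <= 1 /\
  forall p q c z,
    (forall x, Tm x -> z x = ife_side t nu X bm mum p q c x) ->
    (forall x, Tp x -> z x = ife_side t nu X bp mup p q c x) ->
    is_arc_integral (edge_start A i) (edge_end A i) (fun x => dot (z x) (te i))
      (e * (p * (dot t (edge_end A i) - dot t (edge_start A i))
            + q * (kink (/ bm) (/ bp) (r (edge_end A i))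
                   - kink (/ bm) (/ bp) (r (edge_start A i)))
            + c * (l i * O * (h * mum + (1 - h) * mup))))).
{ intros i.
  destruct (edge_moment (edge_start A i) (edge_end A i) (te i) D nu)
    as [e [h [He [Hh HI]]]].
  - apply hte.
  (* A degenerate edge would make the area vanish: take [A i] itself as the point, with weight 1 at
     [i]. *)
  - intros H0; apply hO.
    transitivity (dot (rot (minus (edge_start A i) (A i)))
                    (minus (edge_end A i) (edge_start A i))).
    + rewrite (barycentric_moment A (A i)
        (fun j => match i, j with I1, I1 | I2, I2 | I3, I3 => 1 | _, _ => 0 end) i);
        [destruct i; unfold O; ring | destruct i; ring | destruct i; vector_eq].
    + rewrite H0; unfold rot; coords; ring.
  - apply hedge; destruct i; discriminate.
  - exists e, h; split; [exact He | split; [exact Hh |]].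
    intros p q c z Hm Hp.
    assert (HT : forall s, 0 <= s <= 1 ->
      in_triangle A (lerp (edge_start A i) (edge_end A i) s)).
    { intros s Hs; apply (on_edge_in_triangle A i); exists s; auto. }
    refine (eq_ind _ (is_arc_integral _ _ _) (HI t X bm bp mum mup p q c z _ _) _ _).
    + intros s Hs Hr; apply Hm, hTm; auto.
    + intros s Hs Hr; apply Hp, hTp; auto.
    + rewrite (barycentric_moment A X l i Sl EX); fold O.
      replace (dot t (minus (edge_end A i) (edge_start A i)))
        with (dot t (edge_end A i) - dot t (edge_start A i)) by (coords; ring).
      reflexivity. }
assert (Hch : exists e h : idx -> R, forall i, e i * e i = 1 /\ 0 <= h i <= 1 /\
  forall p q c z,
    (forall x, Tm x -> z x = ife_side t nu X bm mum p q c x) ->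
    (forall x, Tp x -> z x = ife_side t nu X bp mup p q c x) ->
    is_arc_integral (edge_start A i) (edge_end A i) (fun x => dot (z x) (te i))
      (e i * (p * (dot t (edge_end A i) - dot t (edge_start A i))
            + q * (kink (/ bm) (/ bp) (r (edge_end A i))
                   - kink (/ bm) (/ bp) (r (edge_start A i)))
            + c * (l i * O * (h i * mum + (1 - h i) * mup))))).
{ destruct (Hmom I1) as [e1 [h1 H1]], (Hmom I2) as [e2 [h2 H2]],
    (Hmom I3) as [e3 [h3 H3]].
  exists (fun i => match i with I1 => e1 | I2 => e2 | I3 => e3 end),
    (fun i => match i with I1 => h1 | I2 => h2 | I3 => h3 end).
  intros []; assumption. }
clear Hmom; destruct Hch as [e [h Hmom]].
set (g := fun i => kink (/ bm) (/ bp) (r (A i))).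
(* As [e i] is its own inverse, it moves to the right-hand side. *)
destruct (solve_moments (fun i => dot t (A i)) g
  (fun i => l i * O * (h i * mum + (1 - h i) * mup)) (fun i => e i * v i))
  as [p [q [c [Hs Hu]]]].
- assert (Hdot : forall i j k, i <> j -> j <> k -> i <> k ->
    0 <= dot (minus (A j) (A i)) (minus (A k) (A i))).
  { intros i j k Hij Hjk Hik; pose proof (acute_dot_pos _ _ (hobt i)) as H.
    destruct i, j, k; try congruence; cbn [next] in H; try exact H;
      (eapply eq_ind; [exact H | unfold dot; ring]). }
  assert (Hcorner : forall i j k, i <> j -> j <> k -> i <> k ->
    on_segment (A i) (A j) D -> on_segment (A i) (A k) E ->
    (dot t (A j) - dot t (A i)) * (g k - g i)
    - (dot t (A k) - dot t (A i)) * (g j - g i) <> 0).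
  { intros i j k Hij Hjk Hik HDs HEs.
    replace (dot t (A j) - dot t (A i)) with (dot t (minus (A j) (A i))) by (coords; ring).
    replace (dot t (A k) - dot t (A i)) with (dot t (minus (A k) (A i))) by (coords; ring).
    apply (corner_det (A i) (A j) (A k) D E t nu d); auto;
      try (apply Rinv_0_lt_compat; assumption); apply hedge; auto. }
  unfold on_edge, edge_start, edge_end in hD, hE.
  (* Edges [i0] and [j0] meet at the third vertex, taken as corner; relabelling changes the
     determinant at most by a sign. *)
  destruct i0, j0; try (now elim hij); cbn [next] in hD, hE; intros H0.
  + apply (Hcorner I3 I2 I1); try discriminate; auto using on_segment_sym; lra.
  + apply (Hcorner I2 I3 I1); try discriminate; auto using on_segment_sym; lra.
  + apply (Hcorner I3 I1 I2); try discriminate; auto using on_segment_sym; lra.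
  + apply (Hcorner I1 I3 I2); try discriminate; auto using on_segment_sym; lra.
  + apply (Hcorner I2 I1 I3); try discriminate; auto using on_segment_sym; lra.
  + apply (Hcorner I1 I2 I3); try discriminate; auto using on_segment_sym; lra.
(* The sum is [O] times a number that is at least [m], since the weights [l] are nonnegative with
   sum 1. *)
- set (m := Rmin mum mup).
  assert (Hm0 : 0 < m) by (apply Rmin_glb_lt; assumption).
  assert (Hw : forall i, l i * m <= l i * (h i * mum + (1 - h i) * mup)).
  { intros i; apply Rmult_le_compat_l; [apply Hl |].
    destruct (Hmom i) as [_ [Hh _]].
    pose proof (Rmin_l mum mup) as Hl'; pose proof (Rmin_r mum mup) as Hr'.
    fold m in Hl', Hr'.
    nra. }
  pose proof (Hw I1) as Hw1; pose proof (Hw I2) as Hw2; pose proof (Hw I3) as Hw3.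
  intros H0; apply hO.
  apply (Rmult_eq_reg_r (l I1 * (h I1 * mum + (1 - h I1) * mup)
    + l I2 * (h I2 * mum + (1 - h I2) * mup)
    + l I3 * (h I3 * mum + (1 - h I3) * mup))); [lra |].
  assert ((l I1 + l I2 + l I3) * m = m) by (rewrite Sl; ring). lra.
(* On the cut and outside the triangle the plus formula is an arbitrary choice. *)
- set (z := fun x => if Rlt_dec (r x) 0 then ife_side t nu X bm mum p q c x
                     else ife_side t nu X bp mup p q c x).
  assert (Hzm : forall x, Tm x -> z x = ife_side t nu X bm mum p q c x).
  { intros x Hx; apply hTm in Hx; destruct Hx as [_ Hx]; unfold z, r.
    destruct (Rlt_dec _ 0); [reflexivity | lra]. }
  assert (Hzp : forall x, Tp x -> z x = ife_side t nu X bp mup p q c x).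
  { intros x Hx; apply hTp in Hx; destruct Hx as [_ Hx]; unfold z, r.
    destruct (Rlt_dec _ 0); [lra | reflexivity]. }
  exists z; split; [split |].
  + apply (IND_iff _ _ _ _ _ _ _ _ nu); try assumption. exists p, q, c; auto.
  + intros i; destruct (Hmom i) as [He [_ HI]].
    refine (eq_ind _ (is_arc_integral _ _ _) (HI p q c z Hzm Hzp) _ _).
    unfold edge_start, edge_end. fold (g (next (next i))) (g (next i)).
    rewrite (Hs i), <- Rmult_assoc, He; ring.
  + intros z' [HI' Hint'] x Hx.
    apply (IND_iff _ _ _ _ _ _ _ _ nu) in HI'; try assumption.
    destruct HI' as [p' [q' [c' [Hm' Hp']]]]; fold X in Hm', Hp'.
    destruct (Hu p' q' c') as [-> [-> ->]].
    * intros i; destruct (Hmom i) as [He [_ HI]].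
      specialize (HI p' q' c' z' Hm' Hp').
      (* Two values of the same integral agree, which makes [p'], [q'], [c'] a solution of the
         system. *)
      pose proof (eq_trans (eq_sym (is_RInt_unique _ _ _ _ (Hint' i)))
                    (is_RInt_unique _ _ _ _ HI)) as Hv.
      rewrite Hv, <- (Rmult_assoc (e i) (e i)), He, Rmult_1_l; reflexivity.
    * destruct Hx as [Hx | Hx].
      -- rewrite Hm', Hzm by exact Hx; reflexivity.
      -- rewrite Hp', Hzp by exact Hx; reflexivity.
Qed.
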